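(* Let $\mathcal T=(S,2^S,\kappa,\mathrm{AP},\mathcal L)$ be a labelled denumerable Markov chain with a finite attractor, and let $\mathcal M=(Q,q_0,E,\mathcal F)$ be a deterministic Muller automaton over $\mathrm{AP}$. Let $B$ be a finite attractor for $\mathcal T\ltimes\mathcal M$. For every initial distribution $\mu\in\mathrm{Dist}(S)$ for $\mathcal T$: $\mathrm{Prob}^{\mathcal T\ltimes\mathcal M}_{\mu\times\delta_{q_0}}(\mathrm{Inf}\in\mathcal F)=1$ if and only if every BSCC $C$ of $\mathrm{Graph}_{\mathcal T\ltimes\mathcal M}(B)$ such that $\mathrm{Prob}^{\mathcal T\ltimes\mathcal M}_{\mu\times\delta_{q_0}}(\mathbf F C)>0$ is good for $\mathcal F$.
   Context: A labelled denumerable Markov chain is $\mathcal T=(S,2^S,\kappa,\mathrm{AP},\mathcal L)$ with $S$ at most countable, $\kappa$ a Markov kernel on $S$, $\mathrm{AP}$ a finite set of atomic propositions and $\mathcal L:S\to2^{\mathrm{AP}}$. $\mathrm{Dist}(S)$ is the set of probability measures on $S$; $\mathrm{Prob}^{\mathcal T}_\mu$ is the law on $S^\omega$ of the Markov chain with initial distribution $\mu$ and kernel $\kappa$. $\mathbf F B$ is the event that $B$ is visited at some time $i\ge0$. A set $B$ is an attractor for $\mathcal T$ if $\mathrm{Prob}^{\mathcal T}_\mu(\mathbf F B)=1$ for every initial distribution $\mu$. A deterministic Muller automaton over $\mathrm{AP}$ is $\mathcal M=(Q,q_0,E,\mathcal F)$ with $Q$ finite, $q_0\in Q$, $E\subseteq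 Q\times2^{\mathrm{AP}}\times Q$ such that for every $(q,u)$ there is exactly one $q'$ with $(q,u,q')\in E$, and $\mathcal F\subseteq2^Q$. The product $\mathcal T\ltimes\mathcal M$ is the labelled Markov chain with state space $S\times Q$, kernel $\kappa'((s,q),\{(s',q')\})=\kappa(s,\{s'\})$ if $(q,\mathcal L(s),q')\in E$ and $0$ otherwise, and labelling $(s,q)\mapsto q$. $\mathrm{Inf}\in\mathcal F$ is the event that the set of $q\in Q$ occurring infinitely often as second component along the path belongs to $\mathcal F$. $\mathrm{Graph}_{\mathcal T\ltimes\mathcal M}(B)$ is the finite directed graph with vertex set $B$ and an edge from $x$ to $y$ iff there is a path (finite sequence of positive-probability transitions) from $x$ to $y$ in $\mathcal T\ltimes\mathcal M$. A BSCC is a bottom strongly connected component of this graph. A BSCC $C$ is good for $\mathcal F$ if there is $F\in\mathcal F$ such that (a) for every $(s,q)\in S\times Q$ reachable by a path of $\mathcal T\ltimes\mathcal M$ from some element of $C$, $q\in F$; and (b) for every $q\in F$ there is $s\in S$ such that $(s,q)$ is reachable by a path from some element of $C$. *)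

(* Defs.v *)
From HB Require Import structures.
From mathcomp Require Import all_boot all_order all_algebra.
From mathcomp Require Import all_classical all_reals all_analysis measurable_realfun.
From mathcomp Require Import ring lra.
Import Order.TTheory GRing.Theory Num.Theory.
Import numFieldNormedType.Exports.

Set Implicit Arguments.
Unset Strict Implicit.
Unset Printing Implicit Defensive.

Local Open Scope classical_set_scope.
Local Open Scope ring_scope.
Local Open Scope ereal_scope.

(* The set T with the sigma-algebra 2^T. *)
Notation discr T := (g_sigma_algebraType (@discrete_measurable T)).

Lemma discr_measurable (T : pointedType) (A : set (discr T)) : measurable A.
Proof. exact: sub_sigma_algebra. Qed.

(* T^omega with the sigma-algebra generated by the coordinate projections. *)
Definition path_cylinders (T : Type) : set (set (nat -> T)) :=
  [set A | exists n (U : set T), A = [set w | U (w n)]].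
Notation paths T := (g_sigma_algebraType (@path_cylinders T)).

Notation Dist R T := (probability (discr T) R).

Section law.
Context (R : realType) (T : pointedType).
Implicit Types (K : R.-pker discr T ~> discr T) (mu : Dist R T).

(* Prescribes the finite-dimensional distributions; for countable T exactly one
   P satisfies it (markov_law_exists, markov_law_unique). *)
Definition is_markov_law K mu (P : probability (paths T) R) : Prop :=
  forall (s : nat -> T) (n : nat),
    P [set w | forall i, (i <= n)%N -> w i = s i] =
    mu [set s 0%N] * \prod_(0 <= i < n) K (s i) [set s i.+1].

End law.

(* Existence of the law: sampling the successive states of the chain from one
   uniform variable on [0, 1[, by iterated inversion of the distribution
   function. *)
Section law_existence.
Context (R : realType) (T : pointedType).
Variable code : T -> nat.
Hypothesis code_inj : injective code.
Variable K : R.-pker discr T ~> discr T.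
Implicit Types (p : {measure set (discr T) -> \bar R}) (u : R).

Let mass p (t : T) : R := fine (p [set t]).
Let below p (n : nat) : R := fine (p [set t | (code t < n)%N]).
Let pick p (u : R) : T :=
  xget point [set t | (below p (code t) <= u < below p (code t) + mass p t)%R].
Let rescale p (u : R) : R :=
  ((u - below p (code (pick p u))) / mass p (pick p u))%R.
Fixpoint sample_path p (u : R) (n : nat) : T :=
  if n is m.+1 then sample_path (K (pick p u)) (rescale p u) m else pick p u.

Let fin p (p1 : p setT = 1) (A : set T) : p A \is a fin_num.
Proof.
rewrite ge0_fin_numE ?measure_ge0//; apply: (@le_lt_trans _ _ (p setT)).
  by apply: le_measure; rewrite ?inE; [exact: discr_measurable|exact: discr_measurable|].
by rewrite p1 ltry.
Qed.

Let mass_ge0 p t : (0 <= mass p t)%R.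
Proof. exact/fine_ge0/measure_ge0. Qed.

Let below_ge0 p n : (0 <= below p n)%R.
Proof. exact/fine_ge0/measure_ge0. Qed.

Let below_le p (p1 : p setT = 1) m n : (m <= n)%N -> (below p m <= below p n)%R.
Proof.
move=> mn; apply: fine_le; try exact: fin.
apply: le_measure; rewrite ?inE; try exact: discr_measurable.
by move=> t /=/leq_trans; apply.
Qed.

Let below_le1 p (p1 : p setT = 1) n : (below p n <= 1)%R.
Proof.
rewrite -[leRHS]/(fine (1 : \bar R)) -p1; apply: fine_le; try exact: fin.
by apply: le_measure; rewrite ?inE; try exact: discr_measurable.
Qed.

Let belowS p (p1 : p setT = 1) t :
  below p (code t).+1 = (below p (code t) + mass p t)%R.
Proof.
rewrite /below /mass -fineD; try exact: fin.
rewrite -measureU; try exact: discr_measurable.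
  congr (fine (p _)); apply/seteqP; split => x /=.
    by rewrite ltnS leq_eqVlt => /orP[/eqP/code_inj ->|]; [right|left].
  by move=> [/ltnW|->]; rewrite ltnS.
by apply/seteqP; split => x //= [] /[swap] ->; rewrite ltnn.
Qed.

Let pick_uniq p (p1 : p setT = 1) u t t' :
  (below p (code t) <= u < below p (code t) + mass p t)%R ->
  (below p (code t') <= u < below p (code t') + mass p t')%R -> t = t'.
Proof.
move=> /andP[a b] /andP[a' b']; apply: code_inj; apply/eqP.
rewrite eqn_leq leqNgt [X in _ && X]leqNgt; apply/andP; split; apply/negP.
  by move=> /(below_le p1); rewrite belowS//; lra.
by move=> /(below_le p1); rewrite belowS//; lra.
Qed.

Let pick_ex p (p1 : p setT = 1) u : (0 <= u < 1)%R ->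
  exists t, (below p (code t) <= u < below p (code t) + mass p t)%R.
Proof.
move=> /andP[u0 u1].
have [n un] : exists n, (u < below p n)%R.
  have : p \o (fun n => [set t | (code t < n)%N]) @ \oo -->
      p (\bigcup_n [set t | (code t < n)%N]).
    apply: nondecreasing_cvg_mu => [n||m n mn]; try exact: discr_measurable.
    by apply/subsetPset => t /=/leq_trans; apply.
  rewrite (_ : \bigcup_n _ = setT); last first.
    by apply/seteqP; split => // t _; exists (code t).+1 => /=.
  rewrite p1 => /fine_cvgP[_ /cvgrPdist_lt/(_ (1 - u)%R)].
  rewrite subr_gt0 => /(_ u1)[N _ /(_ N (leqnn N))] /= h.
  exists N; move: h; rewrite ger0_norm ?subr_ge0; last exact: (below_le1 p1).
  by rewrite /below; lra.
have [/=] := ex_minnP (ex_intro (fun n => (u < below p n)%R) n un).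
move=> [|m] um mmin.
  move: um; rewrite /below (_ : [set _ | _] = set0) ?measure0/=; first lra.
  by apply/seteqP; split.
have mu_ : (below p m <= u)%R.
  by rewrite leNgt; apply/negP => /mmin; rewrite ltnn.
have [t tm] : exists t, code t = m.
  apply: contrapT => /forallNP h.
  have : below p m = below p m.+1.
    congr (fine (p _)); apply/seteqP; split => t /=; first exact: ltnW.
    by rewrite ltnS leq_eqVlt => /orP[/eqP/h|].
  by move: um mu_; lra.
by exists t; rewrite -belowS// tm mu_.
Qed.

Let pickP p (p1 : p setT = 1) u t : (0 <= u < 1)%R ->
  pick p u = t <-> (below p (code t) <= u < below p (code t) + mass p t)%R.
Proof.
move=> u01; have [t' ht'] := pick_ex p1 u01.
have h : (below p (code (pick p u)) <= u <
          below p (code (pick p u)) + mass p (pick p u))%R.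
  by rewrite /pick; case: xgetP => [x _|/(_ t')].
by split=> [<-//|/(pick_uniq p1 h)].
Qed.

Let rescale01 p (p1 : p setT = 1) u : (0 <= u < 1)%R ->
  (0 <= rescale p u < 1)%R.
Proof.
move=> u01; have /pickP := erefl (pick p u) => /(_ p1 u01) /andP[a b].
have m0 : (0 < mass p (pick p u))%R by lra.
by rewrite /rescale divr_ge0 ?subr_ge0 ?(ltW m0)//= ltr_pdivrMr//; lra.
Qed.

Let K1 t : K t setT = 1.
Proof. exact: prob_kernel. Qed.

Let weight p (s : nat -> T) n : R :=
  (mass p (s 0%N) * \prod_(0 <= i < n) mass (K (s i)) (s i.+1))%R.

Let sample_itv n p (p1 : p setT = 1) (s : nat -> T) :
  exists a : R, [/\ (0 <= a)%R, (0 <= weight p s n)%R, (a + weight p s n <= 1)%R &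
    forall u, (0 <= u < 1)%R ->
      ((forall i, (i <= n)%N -> sample_path p u i = s i) <->
       (a <= u < a + weight p s n)%R)].
Proof.
elim: n p p1 s => [|n IHn] p p1 s.
  exists (below p (code (s 0%N))).
  rewrite /weight big_geq// mulr1; split => //.
    by rewrite -belowS// below_le1.
  move=> u u01; rewrite -pickP//; split => [h|h]; first exact: (h 0%N).
  by move=> i; rewrite leqn0 => /eqP ->.
have [a' [a0 w0 aw1 H]] := IHn _ (K1 (s 0%N)) (fun i => s i.+1).
set w' := weight _ _ _ in w0 aw1 H.
set c := below p (code (s 0%N)); set m := mass p (s 0%N).
have wE : weight p s n.+1 = (m * w')%R by rewrite /weight big_nat_recl.
have m0 : (0 <= m)%R by exact: mass_ge0.
have c0 : (0 <= c)%R by exact: below_ge0.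
have cm1 : (c + m <= 1)%R by rewrite -belowS// below_le1.
have ma : (m * (a' + w') <= m)%R by rewrite ler_piMr.
exists (c + m * a')%R; rewrite wE; split.
- by rewrite addr_ge0// mulr_ge0.
- by rewrite mulr_ge0.
- by rewrite -addrA -mulrDr; lra.
move=> u u01; split=> [h|h].
  have pu : pick p u = s 0%N by exact: (h 0%N).
  have /(pickP p1 _ u01) /andP[h1 h2] := pu.
  have mp : (0 < m)%R by rewrite /m; lra.
  have : (a' <= rescale p u < a' + w')%R.
    by apply/H => [|i ni]; [exact: rescale01|rewrite -pu; exact: (h i.+1)].
  rewrite /rescale pu -/c -/m ler_pdivlMr// ltr_pdivrMr// => /andP[? ?].
  by apply/andP; split; [lra|nra].
have mp : (0 < m)%R.
  rewrite lt_neqAle m0 andbT eq_sym; apply/eqP => m00.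
  by move: h; rewrite m00 !mul0r; lra.
have pu : pick p u = s 0%N.
  apply/pickP => //; rewrite -/c -/m.
  have : (0 <= m * a')%R by rewrite mulr_ge0.
  by move: h; rewrite mulrDr in ma; lra.
case=> [_|i ni] //=; rewrite pu; apply: (iffRL (H _ _)) => //.
  exact: rescale01.
rewrite /rescale pu -/c -/m ler_pdivlMr// ltr_pdivrMr//.
by apply/andP; split; nra.
Qed.

Let sample_meas n p (p1 : p setT = 1) (U : set T) :
  measurable [set u : R | (0 <= u < 1)%R /\ U (sample_path p u n)].
Proof.
elim: n p p1 => [|n IHn] p p1.
  rewrite (_ : [set u : R | _] = \bigcup_(k in [set k | exists2 t, code t = k & U t])
    [set u | (0 <= u < 1)%R /\ code (pick p u) = k]); last first.
    apply/seteqP; split => [u /= [u01 Uu]|u [k [t <- Ut] /=[u01 /code_inj ->]]//].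
    by exists (code (pick p u)) => //; exists (pick p u).
  apply: bigcup_measurable => k [t <- Ut].
  rewrite (_ : [set _ | _] = `[0%R, 1%R[ `&`
     `[below p (code t), below p (code t) + mass p t[)%R; last first.
    apply/seteqP; split=> u /=; rewrite !in_itv/=.
      by move=> [u01 /code_inj/(pickP p1 _ u01)].
    by move=> [u01 /(pickP p1 _ u01) ->].
  exact: measurableI.
rewrite (_ : [set u : R | _] = \bigcup_(k in range code)
    [set u | [/\ (0 <= u < 1)%R, code (pick p u) = k & U (sample_path p u n.+1)]]);
    last first.
  apply/seteqP; split => [u /= [u01 Uu]|u [k _ []]//].
  by exists (code (pick p u)) => //; exists (pick p u).
apply: bigcup_measurable => _ [t _ <-].
set f := fun u : R => ((u - below p (code t)) / mass p t)%R.
rewrite (_ : [set _ | _] = (`[0%R, 1%R[ `&`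
   `[below p (code t), below p (code t) + mass p t[) `&`
   f @^-1` [set u | (0 <= u < 1)%R /\ U (sample_path (K t) u n)])%R; last first.
  apply/seteqP; split=> u /=; rewrite !in_itv/=.
    move=> [u01 /code_inj e Uu]; split.
      by split=> //; apply/pickP.
    by move: (rescale01 p1 u01) Uu; rewrite /rescale e.
  move=> [[u01 /(pickP p1 _ u01) e] [f01 Uf]]; split => //; first by rewrite e.
  by rewrite /rescale e.
apply: measurableI; first exact: measurableI.
rewrite -[X in measurable X]setTI.
have mf : measurable_fun setT f.
  apply: measurable_funM => //; exact: measurable_funB.
by apply: mf => //; exact: IHn.
Qed.

Variable mu : Dist R T.

Let I01 : set R := `[0%R, 1%R[%classic.
Let mI01 : measurable I01. Proof. exact: measurable_itv. Qed.
Let chain (u : R) : paths T :=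
  if (0 <= u < 1)%R then sample_path mu u else point.
Let mu1 : mu setT = 1. Proof. exact: probability_setT. Qed.

Let chain_meas : measurable_fun setT chain.
Proof.
apply: (@measurability _ _ (measurableTypeR R) (paths T) setT chain (@path_cylinders T)) => //.
move=> _ [_ [n [U ->]] <-]; rewrite setTI.
rewrite (_ : _ @^-1` _ = [set u | (0 <= u < 1)%R /\ U (sample_path mu u n)] `|`
    (~` I01 `&` [set u | U ((point : paths T) n)])); last first.
  apply/seteqP; split=> u; rewrite /chain /I01/= in_itv/=;
    case: ifPn => u01 /=; first [by left|by right|by case=> -[]].
apply: measurableU; first exact: sample_meas.
apply: measurableI; first exact: measurableC.
have [Up|nUp] := pselect (U ((point : paths T) n)).
  by rewrite (_ : [set _ | _] = setT)//; apply/seteqP; split.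
by rewrite (_ : [set _ | _] = set0)//; apply/seteqP; split.
Qed.

Let law (A : set (paths T)) : \bar R := mrestr lebesgue_measure mI01 (chain @^-1` A).

Let law0 : law set0 = 0.
Proof. by rewrite /law preimage_set0 measure0. Qed.

Let law_ge0 A : 0 <= law A.
Proof. exact: measure_ge0. Qed.

Let law_sigma : semi_sigma_additive law.
Proof.
move=> F mF tF mUF; rewrite /law preimage_bigcup.
apply: measure_semi_sigma_additive.
- by move=> n; rewrite -[X in measurable X]setTI; exact: chain_meas.
- apply/trivIsetP => /= i j _ _ ij; rewrite -preimage_setI.
  by move/trivIsetP : tF => /(_ _ _ _ _ ij) ->//; rewrite preimage_set0.
- by rewrite -preimage_bigcup -[X in measurable X]setTI; exact: chain_meas.
Qed.

#[local] HB.instance Definition _ := isMeasure.Build _ _ _ law law0 law_ge0 law_sigma.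

Let law1 : law setT = 1.
Proof.
rewrite /law /mrestr preimage_setT setTI lebesgue_measure_itv/=.
by rewrite lte_fin ltr01 oppr0 adde0.
Qed.

#[local] HB.instance Definition _ := Measure_isProbability.Build _ _ _ law law1.

Lemma markov_law_exists_code : exists P, is_markov_law K mu P.
Proof.
exists law => s n; rewrite /= /law /mrestr.
have [a [a0 w0 aw1 H]] := sample_itv n mu1 s.
set w := weight _ _ _ in w0 aw1 H.
transitivity (w%:E); last first.
  rewrite /w /weight EFinM fineK ?fin//; congr (_ * _).
  rewrite -prodEFin; apply: eq_bigr => i _.
  by rewrite fineK// fin.
rewrite (_ : _ `&` _ = `[a, (a + w)%R[%classic); last first.
  apply/seteqP; split=> u /=; rewrite /chain /I01 /= !in_itv/=.
    by move=> [+ u01]; rewrite u01 => /H; exact.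
  move=> aw; have u01 : (0 <= u < 1)%R by lra.
  by rewrite u01; split => //; exact/H.
rewrite lebesgue_measure_itv/= lte_fin.
case: ifPn => [_|]; first by rewrite -EFinB; congr EFin; ring.
by rewrite -leNgt => h; congr EFin; lra.
Qed.

End law_existence.

Section law_theory.
Context (R : realType) (T : pointedType).
Hypothesis cT : countable [set: T].
Variables (K : R.-pker discr T ~> discr T) (mu : Dist R T).

Lemma markov_law_exists : exists P, is_markov_law K mu P.
Proof.
have [code /in2TT code_inj] := countable_injP _ cT.
exact: (markov_law_exists_code code_inj).
Qed.

Let cyl (s : nat -> T) (n : nat) : set (paths T) :=
  [set w | forall i, (i <= n)%N -> w i = s i].
Let cyls : set (set (paths T)) :=
  [set A | A = set0 \/ exists s n, A = cyl s n].

Let cyls_sigma (A : set (paths T)) : measurable A -> <<s cyls >> A.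
Proof.
have [code /in2TT code_inj] := countable_injP _ cT.
have bigcupT_cyls (P : set T) (F : T -> set (paths T)) :
    (forall t, P t -> <<s cyls >> (F t)) -> <<s cyls >> (\bigcup_(t in P) F t).
  move=> PF; pose G k := \bigcup_(t in [set t | P t /\ code t = k]) F t.
  rewrite (_ : \bigcup_(t in P) F t = \bigcup_k G k).
    apply: sigma_algebra_bigcup => k; rewrite /G.
    have [[t [Pt <-]]|h] := pselect (exists t, P t /\ code t = k).
      rewrite (_ : [set _ | _] = [set t]) ?bigcup_set1; first exact: PF.
      by apply/seteqP; split=> x /=; [case=> _ /code_inj|move=> ->].
    rewrite (_ : [set _ | _] = set0) ?bigcup_set0; first exact: sigma_algebra0.
    by apply/seteqP; split=> x //= ?; apply: h; exists x.
  apply/seteqP; split => [w [t Pt Ftw]|w [_ _ [t [Pt _] Ftw]]].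
    by exists (code t) => //; exists t.
  by exists t.
apply: smallest_sub => [|_ [n [U ->]]]; first exact: smallest_sigma_algebra.
rewrite -[X in <<s _ >> X]/((fun w : paths T => w n) @^-1` U).
pose upd (s : nat -> T) k t i := if i == k then t else s i.
have updP s k t (w : nat -> T) :
    (forall i, (i <= k)%N -> w i = upd s k t i) <->
    (forall i, (i < k)%N -> w i = s i) /\ w k = t.
  split=> [h|[h wk] i].
    split=> [i ik|]; last by rewrite h// /upd eqxx.
    by rewrite h ?(ltnW ik)// /upd ltn_eqF.
  by rewrite leq_eqVlt /upd => /orP[/eqP->|ik]; [rewrite eqxx|rewrite ltn_eqF// h].
suff H m s k : <<s cyls >> [set w : paths T |
    (forall i, (i < k)%N -> w i = s i) /\ U (w (k + m)%N)].
  rewrite (_ : _ @^-1` U = [set w : paths T |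
    (forall i, (i < 0)%N -> w i = point) /\ U (w (0 + n)%N)]); first exact: H.
  by apply/seteqP; split=> w //= [].
elim: m s k => [|m IHm] s k.
  rewrite addn0 (_ : [set _ | _] = \bigcup_(t in U) cyl (upd s k t) k).
    apply: bigcupT_cyls => t _; apply: sub_sigma_algebra; right.
    by exists (upd s k t), k.
  apply/seteqP; split=> w /=.
    by move=> [h Uw]; exists (w k) => //; apply/updP.
  by move=> [t Ut /updP[h ->]].
rewrite (_ : [set _ | _] = \bigcup_(t in setT) [set w : paths T |
    (forall i, (i < k.+1)%N -> w i = upd s k t i) /\ U (w (k.+1 + m)%N)]).
  exact: bigcupT_cyls.
rewrite -addSnnS; apply/seteqP; split=> w /=.
  by move=> [h Uw]; exists (w k) => //; split=> //; apply/updP.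
by move=> [t _ [/updP[h _] Uw]].
Qed.

Let cyl_measurable s n : measurable (cyl s n).
Proof.
rewrite (_ : cyl s n = \bigcap_(i in [set i | (i <= n)%N])
    [set w : paths T | [set s i] (w i)]); last by apply/seteqP; split.
by apply: bigcap_measurable => [|i _]; [exists 0%N|
  apply: sub_sigma_algebra; exists i, [set s i]].
Qed.

Lemma markov_law_unique P P' : is_markov_law K mu P -> is_markov_law K mu P' ->
  forall A : set (paths T), measurable A -> P A = P' A.
Proof.
move=> HP HP' A /cyls_sigma.
have [code /in2TT code_inj] := countable_injP _ cT.
pose g k := [set w : paths T | code (w 0%N) = k].
apply: (@g_sigma_algebra_measure_unique _ R (paths T) cyls _ g) => //.
- by move=> _ [->|[s [n ->]]]; [exact: measurable0|exact: cyl_measurable].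
- move=> k; have [[t tk]|h] := pselect (exists t, code t = k); last first.
    by left; apply/seteqP; split=> // w /= wk; apply: h; exists (w 0%N).
  right; exists (fun=> t), 0%N; apply/seteqP; split=> w /=.
    by rewrite /g/= -tk => /code_inj wt i; rewrite leqn0 => /eqP ->.
  by rewrite /g/= => ->.
- by apply/seteqP; split => // w _; exists (code (w 0%N)).
- move=> X Y [->|[s [n ->]]]; first by rewrite set0I; left.
  case=> [->|[s' [n' ->]]]; first by rewrite setI0; left.
  wlog nn' : s n s' n' / (n <= n')%N.
    by move=> h; have [|/ltnW] := leqP n n'; [|rewrite setIC]; exact: h.
  have [e|e] := pselect (forall i, (i <= n)%N -> s i = s' i).
    right; exists s', n'; apply/seteqP; split=> w /= => [[]//|h].
    by split=> // i ik; rewrite h ?e// (leq_trans ik).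
  left; apply/seteqP; split=> // w [h h']; apply: e => i ik.
  by rewrite -h// h'// (leq_trans ik).
- by move=> _ [->|[s [n ->]]]; [rewrite !measure0|exact: etrans (HP s n) (esym (HP' s n))].
- move=> k; apply: (@le_lt_trans _ _ 1); last exact: ltry.
  apply: probability_le1; apply: sub_sigma_algebra.
  by exists 0%N, [set t | code t = k].
Qed.

End law_theory.

(* S is pointed, hence nonempty, only because the library's measurable spaces
   are; Dist R S is empty for an empty S anyway. *)
Record lmc (R : realType) (AP : finType) := LMC {
  state : pointedType;
  state_countable : countable [set: state];
  trans : R.-pker discr state ~> discr state;
  label : state -> {set AP} }.

Definition Prob (R : realType) (AP : finType) (T : lmc R AP)
    (mu : Dist R (state T)) : probability (paths (state T)) R :=
  sval (cid (markov_law_exists (state_countable T) (trans T) mu)).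

Arguments Prob {R AP} T mu.

Lemma Prob_law (R : realType) (AP : finType) (T : lmc R AP)
  (mu : Dist R (state T)) : is_markov_law (trans T) mu (Prob T mu).
Proof. exact: svalP. Qed.

Definition visits (X : Type) (B : set X) : set (nat -> X) :=
  [set w | exists i, B (w i)].

Definition attractor (R : realType) (AP : finType) (T : lmc R AP)
    (B : set (state T)) : Prop :=
  forall mu : Dist R (state T), Prob T mu (visits B) = 1.

Arguments attractor {R AP} T B.

Record muller (AP : finType) := Muller {
  mstate : finType;
  minit : mstate;
  mtrans : {set mstate * {set AP} * mstate};
  mtrans_det : forall q u, exists! q', (q, u, q') \in mtrans;
  macc : {set {set mstate}} }.

(* Q, pointed at q0 (the library asks measurable spaces to be pointed). *)
Definition mstates (AP : finType) (M : muller AP) : Type := mstate M.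
HB.instance Definition _ (AP : finType) (M : muller AP) :=
  Finite.copy (mstates M) (mstate M).
HB.instance Definition _ (AP : finType) (M : muller AP) :=
  isPointed.Build (mstates M) (minit M).

Section product.
Context (R : realType) (AP : finType) (T : lmc R AP) (M : muller AP).
Let S := state T.
Let Q := mstates M.

Definition prod_trans (x : discr (S * Q)%type) (A : set (discr (S * Q)%type)) :
    \bar R :=
  trans T x.1
    [set s' | exists2 q' : Q, (x.2, label x.1, q') \in mtrans M & A (s', q')].

Lemma prod_trans1 s q s' q' :
  prod_trans (s, q) [set (s', q')] =
  if (q, label s, q') \in mtrans M then trans T s [set s'] else 0.
Proof.
rewrite /prod_trans /=; case: ifPn => h.
  congr (trans T s _); apply/seteqP; split => x /=; first by case=> ? _ [].
  by move=> ->; exists q'.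
rewrite (_ : [set _ | _] = set0) ?measure0//.
by apply/seteqP; split => // x /= [q'' + [_ e]]; rewrite e (negbTE h).
Qed.

Let prod_trans0 x : prod_trans x set0 = 0.
Proof.
rewrite /prod_trans (_ : [set _ | _] = set0) ?measure0//.
by apply/seteqP; split => // ? [].
Qed.

Let prod_trans_ge0 x A : 0 <= prod_trans x A.
Proof. exact: measure_ge0. Qed.

Let prod_trans_sigma x : semi_sigma_additive (prod_trans x).
Proof.
move=> F mF tF mUF; rewrite /prod_trans.
have -> : [set s' | exists2 q' : Q, (x.2, label x.1, q') \in mtrans M &
    (\bigcup_n F n) (s', q')] =
  \bigcup_n [set s' | exists2 q' : Q, (x.2, label x.1, q') \in mtrans M &
    F n (s', q')].
  apply/seteqP; split=> s /=; first by case=> q qM [n _ Fn]; exists n => //; exists q.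
  by case=> n _ [q qM Fn]; exists q => //; exists n.
apply: measure_semi_sigma_additive; try by move=> *; exact: discr_measurable.
move=> i j _ _ [s [[q qM Fi] [q' qM' Fj]]].
have [r [_ ru]] := mtrans_det x.2 (label x.1).
apply: (tF i j) => //; exists (s, q); split => //.
by rewrite -(ru _ qM) (ru _ qM').
Qed.

HB.instance Definition _ x := isMeasure.Build _ _ _ (prod_trans x)
  (prod_trans0 x) (prod_trans_ge0 x) (@prod_trans_sigma x).

Definition prod_kernel (x : discr (S * Q)%type) :
  {measure set (discr (S * Q)%type) -> \bar R} := prod_trans x.

Let prod_kernel_meas U : measurable U ->
  measurable_fun [set: discr (S * Q)%type] (prod_kernel ^~ U).
Proof. by move=> _ _ Y _; exact: discr_measurable. Qed.

HB.instance Definition _ := isKernel.Build _ _ _ _ _ prod_kernel prod_kernel_meas.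

Let prod_kernel1 x : prod_kernel x setT = 1.
Proof.
rewrite /prod_kernel /= /prod_trans -(@prob_kernel _ _ _ _ _ (trans T) x.1).
congr (trans T _ _); apply/seteqP; split => // s _ /=.
by have [r [rM _]] := mtrans_det x.2 (label x.1); exists r.
Qed.

HB.instance Definition _ :=
  Kernel_isProbability.Build _ _ _ _ _ prod_kernel prod_kernel1.

Let prod_countable : countable [set: (S * Q)%type].
Proof.
rewrite -setXTT; apply: countableX; first exact: state_countable.
exact: (finite_set_countable (@finite_finset Q setT)).
Qed.

(* A state (s, q) carries the single atomic proposition q. *)
Definition prod_lmc : lmc R (mstate M) :=
  @LMC R (mstate M) (S * Q)%type prod_countable prod_kernel
    (fun x => [set (x.2 : mstate M)]%SET).

Lemma prod_measurable (A : set (discr S * discr Q)%type) : measurable A.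
Proof.
rewrite (_ : A = \bigcup_(q in [set: Q]) ([set s | A (s, q)] `*` [set q])).
  apply: fin_bigcup_measurable; first exact: (@finite_finset Q setT).
  by move=> q _; apply: measurableX; exact: discr_measurable.
by apply/seteqP; split=> [[s q] Asq|[s q] [q' _ [/= + ->]]//]; exists q.
Qed.

(* mu x delta_q0. Every subset of S x Q is measurable for the product
   sigma-algebra; the measure is only transported along this equality. *)
Definition init_measure (mu : Dist R S) : set (discr (S * Q)%type) -> \bar R :=
  (mu \x (\d_(minit M : discr Q) : probability (discr Q) R))%E.

Section init_probability.
Variable mu : Dist R S.

Let init0 : init_measure mu set0 = 0.
Proof. exact: measure0. Qed.

Let init_ge0 A : 0 <= init_measure mu A.
Proof. exact: measure_ge0. Qed.

Let init_sigma : semi_sigma_additive (init_measure mu).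
Proof.
move=> F mF tF mUF.
by apply: (@measure_semi_sigma_additive _ (discr S * discr Q)%type) => // *;
  exact: prod_measurable.
Qed.

HB.instance Definition _ := isMeasure.Build _ _ _ (init_measure mu)
  init0 init_ge0 init_sigma.

Let init1 : init_measure mu setT = 1.
Proof. exact: probability_setT. Qed.

HB.instance Definition _ := Measure_isProbability.Build _ _ _ (init_measure mu) init1.

Definition init : Dist R (S * Q)%type := init_measure mu.

Lemma init_pair s q : init [set (s, q)] = mu [set s] * (q == minit M)%:R%:E.
Proof.
have -> : [set (s, q)] = [set s] `*` [set q].
  by apply/seteqP; split=> -[a b] /= [-> ->].
apply: etrans (product_measure1E mu (\d_(minit M : discr Q) : probability (discr Q) R)
  (discr_measurable [set s]) (discr_measurable [set q])) _.
by congr (_ * _); rewrite /= diracE (@in_set1 (mstate M)) eq_sym.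
Qed.

End init_probability.

End product.

Arguments init {R AP T} M mu.

(* Reflexive-transitive closure: a finite sequence of e-steps from x to y. *)
Definition walk (X : Type) (e : X -> X -> Prop) (x y : X) : Prop :=
  exists p : seq X, path.path (fun a b => `[< e a b >]) x p /\ last x p = y.

Definition reach (R : realType) (AP : finType) (T : lmc R AP) :
    state T -> state T -> Prop :=
  walk (fun x y => 0 < trans T x [set y]).

Arguments reach {R AP} T x y.

Section digraph.
Context (X : Type) (V : set X) (e : X -> X -> Prop).

Definition strongly_connected (C : set X) : Prop :=
  forall x y, C x -> C y -> walk e x y.

Definition scc (C : set X) : Prop :=
  [/\ C !=set0, C `<=` V, strongly_connected C &
      forall D, C `<=` D -> D `<=` V -> strongly_connected D -> D = C].

Definition bscc (C : set X) : Prop :=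
  scc C /\ forall x y, C x -> e x y -> C y.

End digraph.

(* Edges of Graph_T(B); its vertex set is B. *)
Definition graph_edge (R : realType) (AP : finType) (T : lmc R AP)
    (B : set (state T)) (x y : state T) : Prop :=
  [/\ B x, B y & reach T x y].

Arguments graph_edge {R AP} T B x y.

Section muller_condition.
Context (R : realType) (AP : finType) (T : lmc R AP) (M : muller AP).

Definition inf_states (w : nat -> state (prod_lmc T M)) : {set mstate M} :=
  [set q : mstate M |
    `[< forall n, exists2 i, (n <= i)%N & (w i).2 = q :> mstate M >]]%SET.

Definition inf_in (F : {set {set mstate M}}) :
    set (nat -> state (prod_lmc T M)) :=
  [set w | inf_states w \in F].

Definition good_for (F : {set {set mstate M}}) (C : set (state (prod_lmc T M))) :
    Prop :=
  exists2 A : {set mstate M}, A \in F &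
    (forall x y, C x -> reach (prod_lmc T M) x y -> y.2 \in A) /\
    (forall q, q \in A -> exists s x, C x /\ reach (prod_lmc T M) x (s, q)).

End muller_condition.

(* Main.v *)
(** Almost every path of the product chain is regular: all its transitions have
    positive probability, the attractor [B] is visited infinitely often, and a
    state visited infinitely often brings along every state reachable from it.
    As [B] is finite, a regular path visits some [b] in [B] infinitely often;
    then every state reachable from [b] is visited infinitely often, and after
    the first visit to [b] no other state is visited. Hence the elements of [B]
    reachable from [b] form a BSCC, the only one that the path visits, and this
    BSCC is good for [F] iff the path satisfies [Inf \in F]. *)
Require Import Defs.
From mathcomp Require Import all_boot all_order all_algebra.
From mathcomp Require Import all_classical all_reals all_analysis.
Import Order.TTheory GRing.Theory Num.Theory.

Set Implicit Arguments.
Unset Strict Implicit.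
Unset Printing Implicit Defensive.

Local Open Scope classical_set_scope.
Local Open Scope ring_scope.
Local Open Scope ereal_scope.

(** * Measurable events on path space and infinitely frequent visits *)

Definition cylinder (T : pointedType) (s : nat -> T) (n : nat) : set (paths T) :=
  [set w | forall i, (i <= n)%N -> w i = s i].

Definition shift (T : pointedType) (n : nat) (w : paths T) : paths T :=
  fun i => w (n + i)%N.

Lemma measurable_coord (T : pointedType) (n : nat) (U : set T) :
  measurable ([set w | U (w n)] : set (paths T)).
Proof. by apply: sub_sigma_algebra; exists n, U. Qed.

Lemma measurable_cylinder (T : pointedType) (s : nat -> T) (n : nat) :
  measurable (cylinder s n).
Proof.
rewrite (_ : cylinder s n =
    \bigcap_(i in [set i | (i <= n)%N]) [set w | [set s i] (w i)]).
  by apply: bigcap_measurable => [|i _]; [exists 0%N | exact: measurable_coord].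
by apply/seteqP; split.
Qed.

Lemma measurable_shift (T : pointedType) (n : nat) :
  measurable_fun setT (@shift T n).
Proof.
apply: (@measurability _ _ (paths T) (paths T) setT _ (@path_cylinders T)) => //.
by move=> _ [_ [m [U ->]] <-]; rewrite setTI; exact: measurable_coord.
Qed.

Lemma measurable_shift_preimage (T : pointedType) n (D : set (paths T)) :
  measurable D -> measurable (@shift T n @^-1` D).
Proof. by move=> mD; rewrite -[Y in measurable Y]setTI; exact: measurable_shift. Qed.

Definition infinitely_often (T : pointedType) (U : set T) : set (paths T) :=
  [set w | forall n, exists2 i, (n <= i)%N & U (w i)].

Lemma measurable_infinitely_often (T : pointedType) (U : set T) :
  measurable (infinitely_often U).
Proof.
rewrite (_ : infinitely_often U = \bigcap_(n in setT)
    \bigcup_(i in [set i | (n <= i)%N]) [set w | U (w i)]).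
  apply: bigcap_measurable => [|n _]; first by exists 0%N.
  by apply: bigcup_measurable => i _; exact: measurable_coord.
by apply/seteqP; split=> [w h n _|w h n];
  [have [i ni wi] := h n; exists i|have [i ni wi] := h n I; exists i].
Qed.

(** An injective code of [J] into [nat] reduces this to a union over [nat]: each fibre of the code
    is empty or a single index. *)
Lemma negligible_bigcup_countable d (X : measurableType d) (R : realType)
    (P : {measure set X -> \bar R}) (J : Type) (F : J -> set X) :
  countable [set: J] -> (forall j, P.-negligible (F j)) ->
  P.-negligible (\bigcup_j F j).
Proof.
move=> cJ F0; have [code /in2TT code_inj] := countable_injP _ cJ.
apply: (@negligibleS _ _ _ _
    (\bigcup_k \bigcup_(j in [set j | code j = k]) F j)).
  by move=> x [j _ Fj]; exists (code j) => //; exists j.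
apply: negligible_bigcup => k.
have [[j <-]|h] := pselect (exists j, code j = k).
  apply: negligibleS (F0 j) => x [j' /= e Fj'].
  by rewrite -(code_inj _ _ e).
apply: negligibleS (negligible_set0 P) => x [j /= e _].
by apply: h; exists j.
Qed.

Lemma measurable_visits (T : pointedType) (B : set T) :
  measurable (visits B : set (paths T)).
Proof.
rewrite (_ : visits B = \bigcup_i [set w | B (w i)]).
  by apply: bigcupT_measurable => i; exact: measurable_coord.
by apply/seteqP; split=> w [i]; [exists i|move=> _ Bi; exists i].
Qed.

Lemma infinitely_oftenU (T : pointedType) (U V : set T) :
  infinitely_often (U `|` V) `<=` infinitely_often U `|` infinitely_often V.
Proof.
move=> w h; have [|/existsNP[m Um]] := pselect (infinitely_often U w); first by left.
right=> n; have [i mni Bi] := h (maxn m n).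
exists i; first by rewrite (leq_trans _ mni)// leq_maxr.
case: Bi => // Ui; exfalso; apply: Um; exists i => //.
by rewrite (leq_trans _ mni)// leq_maxl.
Qed.

(** Pigeonhole, by induction on an enumeration of [B]: splitting off one element, either it or the
    rest is met infinitely often. *)
Lemma infinitely_often_finite (T : pointedType) (B : set T) (w : paths T) :
  finite_set B -> infinitely_often B w ->
  exists2 b, B b & infinitely_often [set b] w.
Proof.
move=> /finite_seqP[s ->]; elim: s => [|b s IHs]; first by move=> /(_ 0%N)[].
have -> : [set` (b :: s)] = [set b] `|` [set` s].
  apply/seteqP; split=> x /=; rewrite in_cons.
    by move=> /orP[/eqP ->|]; [left|right].
  by move=> [->|->]; rewrite ?eqxx ?orbT.
move=> /infinitely_oftenU[iob|/IHs[c sc ioc]].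
  by exists b => //; left.
by exists c => //; right.
Qed.

(** Fixing the start at [x] and avoiding [y] from time 0 on makes the event reproduce itself: a path
    in it, shifted to any return to [x], is in it again. *)
Definition recurrent_avoiding (T : pointedType) (x y : T) : set (paths T) :=
  infinitely_often [set x] `&` [set w | w 0%N = x /\ forall i, w i <> y].

Lemma measurable_recurrent_avoiding (T : pointedType) (x y : T) :
  measurable (recurrent_avoiding x y).
Proof.
apply: measurableI; first exact: measurable_infinitely_often.
rewrite (_ : [set _ | _] = [set w | [set x] (w 0%N)] `&`
    \bigcap_(i in setT) [set w | (~` [set y]) (w i)]).
  apply: measurableI; first exact: measurable_coord.
  by apply: bigcap_measurable => [|i _]; [exists 0%N|exact: measurable_coord].
by apply/seteqP; split=> w [? h]; split=> // i; [move=> _; exact: h|exact: h].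
Qed.

Lemma infinitely_often_shift (T : pointedType) (U : set T) n (w : paths T) :
  infinitely_often U w -> infinitely_often U (shift n w).
Proof.
move=> io m; have [i mi Ui] := io (n + m)%N; exists (i - n)%N.
  by rewrite leq_subRL// (leq_trans _ mi)// leq_addr.
by rewrite /shift subnKC// (leq_trans _ mi)// leq_addr.
Qed.

(** * Splitting events along finite prefixes *)

Section words.
Context (R : realType) (T : pointedType).
Hypothesis cT : countable [set: T].
Implicit Types (P : probability (paths T) R) (E : set (paths T)).

Lemma cylinder_word (U : eqType) (f : T -> U) (w w' : paths T) n n' :
  injective f ->
  map f (mkseq w n.+1) = map f (mkseq w' n'.+1) -> n = n' /\ cylinder w n w'.
Proof.
move=> f_inj /(inj_map f_inj) e.
have nn' : n = n' by move/(congr1 size): e; rewrite !size_mkseq => -[].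
split=> // i ni; move/(congr1 (fun s => nth point s i)): e.
by rewrite !nth_mkseq -?nn'.
Qed.

(** There are only countably many finite prefixes, and the paths of [E] for which a given prefix is
    chosen lie in one cylinder, so [E] is a countable union of negligible pieces. *)
Lemma negligible_cylinders P E :
  (forall w, E w -> exists n, P.-negligible (cylinder w n `&` E)) ->
  P.-negligible E.
Proof.
move=> locE; have [code /in2TT code_inj] := countable_injP _ cT.
pose F (u : seq nat) := [set w | E w /\ exists2 n,
  P.-negligible (cylinder w n `&` E) & map code (mkseq w n.+1) = u].
apply: (@negligibleS _ _ _ _ (\bigcup_u F u)).
  by move=> w Ew; have [n h] := locE w Ew; exists (map code (mkseq w n.+1)) => //;
    split=> //; exists n.
apply: negligible_bigcup_countable => [|u]; first exact: countableP.
have [[w [Ew [n h e]]]|hF] := pselect (F u !=set0); last first.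
  by apply: negligibleS (negligible_set0 P) => w Fw; apply: hF; exists w.
apply: negligibleS h => w' [Ew' [n' h' e']]; split=> //.
by have [] := cylinder_word code_inj (etrans e (esym e')).
Qed.

(* [stop w n] says that the stopping time takes the value [n] along [w]. *)
Lemma le_stopping_time P (stop : paths T -> nat -> Prop) E (a : R) :
  measurable E ->
  (forall w n w', stop w n -> cylinder w n w' -> stop w' n) ->
  (forall w n m, stop w n -> stop w m -> n = m) ->
  (forall w n, stop w n -> P (cylinder w n `&` E) <= a%:E * P (cylinder w n)) ->
  (forall w, E w -> exists n, stop w n) ->
  measurable [set w | exists n, stop w n] /\
  P E <= a%:E * P [set w | exists n, stop w n].
Proof.
move=> mE stop_adapted stop_fun stopE Estop.
have [code /in2TT code_inj] := countable_injP _ cT.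
(* [F k] fixes the prefix up to the stopping time by its number [k]. Each nonempty [F k] is a single
   cylinder, so the bound [stopE] applies to it, and the bounds add up over the disjoint [F k]. *)
pose F (k : nat) := [set w : paths T | exists2 n, stop w n &
  pickle (map code (mkseq w n.+1)) = k].
have FE k : F k = set0 \/ exists w n, stop w n /\ F k = cylinder w n.
  have [[w [n sn e]]|hF] := pselect (F k !=set0); last first.
    by left; apply/seteqP; split=> // w Fw; apply: hF; exists w.
  right; exists w, n; split=> //.
  apply/seteqP; split=> [w' [n' sn' e']|w' ww'].
    have e2 := pcan_inj pickleK (etrans e (esym e')).
    by have [] := cylinder_word code_inj e2.
  exists n; first exact: stop_adapted ww'.
  rewrite -e; congr (pickle (map code _)); apply/eq_in_map => i.
  by rewrite mem_iota => /andP[_]; rewrite add0n ltnS => /ww'.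
have mF k : measurable (F k).
  by have [->|[w [n [_ ->]]]] := FE k; [exact: measurable0|exact: measurable_cylinder].
have tF : trivIset setT F.
  move=> k l _ _ [w [[n sn <-] [m sm <-]]].
  by rewrite (stop_fun _ _ _ sn sm).
have stopF : [set w | exists n, stop w n] = \bigcup_k F k.
  apply/seteqP; split=> [w [n sn]|w [k _ [n sn _]]]; last by exists n.
  by exists (pickle (map code (mkseq w n.+1))) => //; exists n.
rewrite stopF; split; first exact: bigcupT_measurable.
have -> : E = \bigcup_k (F k `&` E).
  rewrite -setI_bigcupl -stopF; apply/seteqP; split=> [w Ew|w []//].
  by split=> //; exact: Estop.
have mFE k : measurable (F k `&` E) by exact: measurableI.
rewrite !measure_bigcup//; last exact: trivIset_setIr.
rewrite -nneseriesZl//; apply: lee_nneseries => // k _.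
by have [->|[w [n [sn ->]]]] := FE k; [rewrite set0I measure0 mule0|exact: stopE].
Qed.

End words.

(** * The Markov property and almost sure regularity of paths *)

Section chain.
Context (R : realType) (AP : finType) (X : lmc R AP).
Let T := state X.
Implicit Types (mu : Dist R T) (t x y : T) (w : paths T).

Notation Pr mu := (Prob X mu).

Definition start t : Dist R T := (\d_(t : discr T) : probability (discr T) R).

Lemma start_set1 t x : start t [set x] = (t == x)%:R%:E.
Proof.
by rewrite /= diracE; congr (_%:R%:E); congr nat_of_bool; apply/idP/eqP; rewrite inE.
Qed.

(* Conditioned on the cylinder, the shifted path has the finite-dimensional
   distributions of the chain started at [s n]; uniqueness of the law concludes. *)
Lemma markov_cylinder mu (s : nat -> T) n (D : set (paths T)) : measurable D ->
  Pr mu (cylinder s n `&` shift n @^-1` D) =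
  Pr mu (cylinder s n) * Pr (start (s n)) D.
Proof.
move=> mD.
have mC := measurable_cylinder s n.
(* Conditioning divides by the probability of the cylinder, so a null cylinder is treated apart;
   both sides are then 0. *)
have [C0|Cneq0] := eqVneq (Pr mu (cylinder s n)) 0.
  rewrite C0 mul0e; apply/eqP; rewrite -measure_le0 -C0.
  apply: le_measure; rewrite ?inE//; apply: measurableI => //.
  exact: measurable_shift_preimage.
have Cfin : Pr mu (cylinder s n) \is a fin_num.
  exact: fin_num_measure.
(* The last argument [Pr mu] is the value that [mnormalize] takes for a measure of mass zero or
   infinity; [Cneq0] and [Cfin] exclude both. *)
pose Q0 : probability (paths T) R := mnormalize (mrestr (Pr mu) mC) (Pr mu).
have Q0E E : Q0 E = Pr mu (E `&` cylinder s n) * ((fine (Pr mu (cylinder s n)))^-1)%:E.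
  rewrite /Q0/= /mnormalize/= /mrestr setTI (negbTE Cneq0)/=.
  by case: eqP => // e; move: Cfin; rewrite e.
pose sh : {mfun paths T >-> paths T} := mfun_Sub (mem_set (@measurable_shift T n)).
pose Q : probability (paths T) R := distribution Q0 sh.
have QE E : Q E = Pr mu (cylinder s n `&` shift n @^-1` E) *
    ((fine (Pr mu (cylinder s n)))^-1)%:E.
  by have := Q0E (shift n @^-1` E); rewrite setIC => <-.
have QD : Q D = Pr (start (s n)) D.
  apply: (markov_law_unique (state_countable X) (mu := start (s n)) _ (Prob_law _)) => //.
  move=> s' m; rewrite QE start_set1.
  have [e|/eqP ne] := pselect (s n = s' 0%N); last first.
    rewrite (negbTE ne) mul0e (_ : _ `&` _ = set0) ?measure0 ?mul0e//.
    apply/seteqP; split=> // w [wC /(_ 0%N (leq0n _))].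
    by rewrite /shift addn0 wC// => /eqP; rewrite (negbTE ne).
  rewrite e eqxx mul1e.
  (* [g] glues [s'] to [s] at time [n]. The two share that position, which is consistent because
     [s n = s' 0]. *)
  pose g i := if (i <= n)%N then s i else s' (i - n)%N.
  have gS j : g (n + j)%N = s' j.
    rewrite /g; case: ifPn; last by rewrite addKn.
    by rewrite -{2}[n]addn0 leq_add2l leqn0 => /eqP ->; rewrite addn0.
  have gs i : (i <= n)%N -> g i = s i by move=> h; rewrite /g h.
  rewrite (_ : _ `&` _ = cylinder g (n + m)%N); last first.
    apply/seteqP; split=> w.
      move=> [wC wS] i inm; have [ile|ni] := leqP i n; first by rewrite gs// wC.
      rewrite -(subnKC (ltnW ni)) gS; apply: (wS (i - n)%N).
      by rewrite leq_subLR.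
    move=> wg; split=> i h.
      by rewrite wg ?gs// (leq_trans h)// leq_addr.
    by rewrite /shift wg ?gS// leq_add2l.
  transitivity (Pr mu (cylinder s n) *
      \prod_(0 <= i < m) trans X (s' i) [set s' i.+1] *
      ((fine (Pr mu (cylinder s n)))^-1)%:E).
    congr (_ * _).
    rewrite [LHS](Prob_law mu g (n + m)%N) [Pr mu _](Prob_law mu s n).
    rewrite (@big_cat_nat _ _ _ n)//= ?leq_addr// gs// muleA; congr (_ * _ * _).
      by apply: eq_big_nat => i /andP[_ ni]; rewrite !gs// ltnW.
    rewrite -{1}[n]add0n big_addn addKn; apply: eq_bigr => i _.
    by rewrite addnC -addnS !gS.
  rewrite muleAC -[X in X * _ * _]fineK// -EFinM mulfV ?mul1e//.
  by rewrite fine_eq0.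
rewrite -QD QE muleCA -[X in _ * (X * _)]fineK// -EFinM mulfV ?mule1//.
by rewrite fine_eq0.
Qed.

Lemma negligible_cylinder_shift mu (s : nat -> T) n (D : set (paths T)) :
  measurable D -> Pr (start (s n)) D = 0 ->
  (Pr mu).-negligible (cylinder s n `&` @shift T n @^-1` D).
Proof.
move=> mD D0; apply/negligibleP.
  by apply: measurableI; [exact: measurable_cylinder|exact: measurable_shift_preimage].
by rewrite [LHS]markov_cylinder// D0 mule0.
Qed.

(** Whatever the state at time [n], the Markov property restarts the chain there, and [D] is null
    from every state. *)
Lemma negligible_shift mu n (D : set (paths T)) : measurable D ->
  (forall t, Pr (start t) D = 0) -> (Pr mu).-negligible (@shift T n @^-1` D).
Proof.
move=> mD D0; apply: (negligible_cylinders (state_countable X)) => w _.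
by exists n; exact: negligible_cylinder_shift.
Qed.

(** A prefix ending with a null transition has a zero factor in the product giving its
    probability. *)
Lemma negligible_null_transition mu :
  (Pr mu).-negligible [set w | ~ forall i, 0 < trans X (w i) [set w i.+1]].
Proof.
apply: (negligible_cylinders (state_countable X)) => w /existsNP[i /negP Ki].
exists i.+1; apply: (@negligibleS _ _ _ _ (cylinder w i.+1)) => [|]; first by move=> v [].
apply/negligibleP; first exact: measurable_cylinder.
rewrite [LHS](Prob_law mu w i.+1) big_nat_recr//=.
have -> : trans X (w i) [set w i.+1] = 0.
  by apply/eqP; rewrite -measure_le0 leNgt.
by rewrite !mule0.
Qed.

(** A path with finitely many visits to [B] has a shift that misses [B] altogether, and an attractor
    is missed with probability 0 from every start. *)
Lemma negligible_not_infinitely_often mu (B : set T) : attractor X B ->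
  (Pr mu).-negligible (~` infinitely_often B).
Proof.
move=> attrB; apply: (@negligibleS _ _ _ _ (\bigcup_n (@shift T n @^-1` ~` visits B))).
  move=> w /existsNP[n h]; exists n => // -[i Bi]; apply: h; exists (n + i)%N => //.
  exact: leq_addr.
apply: negligible_bigcup => n; apply: negligible_shift => [|t].
  by apply: measurableC; exact: measurable_visits.
rewrite probability_setC; last exact: measurable_visits.
by rewrite attrB subee.
Qed.

(* By the Markov property at the first return to [x], the probability [a] of
   this event satisfies [a <= a * (1 - p)], where [p > 0] is the probability of
   the transition from [x] to [y]. *)
Lemma prob_recurrent_avoid x y : 0 < trans X x [set y] ->
  Pr (start x) (recurrent_avoiding x y) = 0.
Proof.
move=> p0; set D := recurrent_avoiding x y.
have mD : measurable D by exact: measurable_recurrent_avoiding.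
pose P := Pr (start x); pose a := fine (P D).
have aE : P D = a%:E by rewrite fineK// fin_num_measure.
(* First return to [x], restricted to paths whose first step is not [y]. As [0 < n], the prefix up
   to time [n] includes [w 1], so stopping is decided by that prefix. *)
pose stop (w : paths T) n := [/\ w 0%N = x, w 1%N <> y, (0 < n)%N, w n = x &
  forall i, (0 < i < n)%N -> w i <> x].
have [||||mG] := @le_stopping_time R T (state_countable X) P stop D a mD.
- move=> w n w' [w0 w1 n0 wn wi] ww'; split => //; rewrite ?ww'//.
  by move=> i /andP[i0 ni]; rewrite ww' ?(ltnW ni)//; apply: wi; rewrite i0.
- move=> w n m [_ _ n0 wn ltn] [_ _ m0 wm ltm].
  case: (ltngtP n m) => // h; exfalso.
    by apply: (ltm n _ wn); rewrite n0.
  by apply: (ltn m _ wm); rewrite m0.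
- move=> w n [w0 w1 n0 wn wi]; rewrite -aE muleC.
  (* At time [n] the path is back at [x], so a path of [D] shifted by [n] is again in [D]; the
     Markov property then yields the factor [a]. *)
  apply: (@le_trans _ _ (P (cylinder w n `&` @shift T n @^-1` D))).
    apply: le_measure; rewrite ?inE.
    + by apply: measurableI => //; exact: measurable_cylinder.
    + apply: measurableI; [exact: measurable_cylinder|exact: measurable_shift_preimage].
    + move=> v [vw [iov [v0 vy]]]; split=> //; split; first exact: infinitely_often_shift.
      by split=> [|i]; [rewrite /shift addn0 vw|exact: vy].
  by rewrite markov_cylinder// wn.
- move=> w [iow [w0 wy]].
  have [i0 i01 wi0] := iow 1%N.
  have /ex_minnP[n /andP[n0 /eqP wn] nmin] : exists n, (0 < n)%N && (w n == x).
    by exists i0; apply/andP; split=> //; apply/eqP.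
  exists n; split=> // i /andP[i0' ni] wi.
  by move: ni; rewrite ltnNge nmin// i0' wi eqxx.
rewrite -/P aE => aG.
(* Only [s 0] and [s 1] matter: from [x], the cylinder of this prefix has the probability of the
   step to [y], and [stop] excludes it. This gives the factor [1 - p]. *)
pose s (i : nat) := if i is 0%N then x else y.
have KE : trans X x [set y] = P (cylinder s 1%N).
  by rewrite [RHS](Prob_law (start x) s 1%N) big_nat1 start_set1 eqxx mul1e.
have Gs : P [set w | exists n, stop w n] <= 1 - trans X x [set y].
  rewrite KE -probability_setC; last exact: measurable_cylinder.
  apply: le_measure; rewrite ?inE//.
    by apply: measurableC; exact: measurable_cylinder.
  by move=> w [n [_ w1 _ _ _]] /(_ 1%N (leqnn _)).
have a0 : (0 <= a)%R by exact/fine_ge0/measure_ge0.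
have pfin : trans X x [set y] \is a fin_num.
  by rewrite KE fin_num_measure//; exact: measurable_cylinder.
have {aG}aG : a%:E <= a%:E * (1 - trans X x [set y]).
  by apply: le_trans aG _; apply: lee_wpmul2l.
move: p0 aG; rewrite -(fineK pfin) -EFinB -EFinM lee_fin lte_fin.
set p := fine _ => p0 aG; congr EFin; apply/eqP; rewrite eq_le a0 andbT.
rewrite -(pmulr_lle0 _ p0).
by move: aG; rewrite mulrBr mulr1 -subr_ge0 addrAC subrr add0r oppr_ge0.
Qed.

(** If [y] is never visited from time [N] on, then shifting to a visit to [x] after [N] leads into
    [recurrent_avoiding x y], which is null from [x]. *)
Lemma negligible_recurrent_edge mu x y : 0 < trans X x [set y] ->
  (Pr mu).-negligible (infinitely_often [set x] `\` infinitely_often [set y]).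
Proof.
move=> p0.
apply: (@negligibleS _ _ _ _ (\bigcup_N
    (infinitely_often [set x] `&` [set w | forall i, (N <= i)%N -> w i <> y]))).
  move=> w [iox /existsNP[N h]]; exists N => //; split=> // i Ni wi.
  by apply: h; exists i.
apply: negligible_bigcup => N.
apply: (negligible_cylinders (state_countable X)) => w [iox _].
have [n Nn wn] := iox N; exists n.
have n0 : (Pr mu).-negligible
    (cylinder w n `&` @shift T n @^-1` recurrent_avoiding x y).
  apply: negligible_cylinder_shift; first exact: measurable_recurrent_avoiding.
  by rewrite wn; exact: prob_recurrent_avoid.
apply: negligibleS n0 => v [vw [iov vy]]; split=> //.
split; first exact: infinitely_often_shift.
split=> [|i]; first by rewrite /shift addn0 vw.
by apply: vy; rewrite (leq_trans Nn)// leq_addr.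
Qed.

(** Induction on the walk from [x] through its next state [z]: recurrence is lost either between [x]
    and [z] or between [z] and [y]. *)
Lemma negligible_recurrent_reach mu x y : reach X x y ->
  (Pr mu).-negligible (infinitely_often [set x] `\` infinitely_often [set y]).
Proof.
case=> p; elim: p x => [|z p IHp] x /= [].
  by move=> _ ->; rewrite setDv; exact: negligible_set0.
move=> /andP[/asboolP xz zp] lp.
apply: negligibleS (negligibleU (negligible_recurrent_edge mu xz) (IHp z (conj zp lp))).
move=> w [iox ioy]; have [ioz|ioz] := pselect (infinitely_often [set z] w).
  by right.
by left.
Qed.

Definition regular (B : set T) : set (paths T) := [set w |
  [/\ forall i, 0 < trans X (w i) [set w i.+1], infinitely_often B w &
      forall x y, reach X x y ->
        infinitely_often [set x] w -> infinitely_often [set y] w]].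

Lemma negligible_not_regular mu (B : set T) : attractor X B ->
  (Pr mu).-negligible (~` regular B).
Proof.
move=> attrB.
(* One exceptional set per pair of states: the pairs are countably many, so one null set serves all
   of them. *)
pose N (xy : T * T) := [set w : paths T | reach X xy.1 xy.2 /\
  (infinitely_often [set xy.1] `\` infinitely_often [set xy.2]) w].
have N0 : (Pr mu).-negligible (\bigcup_xy N xy).
  apply: negligible_bigcup_countable => [|[x y]].
    by rewrite -setXTT; apply: countableX; exact: state_countable.
  have [rxy|nr] := pselect (reach X x y).
    by apply: negligibleS (negligible_recurrent_reach mu rxy) => w [].
  by apply: negligibleS (negligible_set0 _) => w [].
apply: negligibleS (negligibleU (negligible_null_transition mu)
  (negligibleU (negligible_not_infinitely_often mu attrB) N0)).
move=> w nreg; apply: contrapT => /not_orP[/contrapT h1 /not_orP[/contrapT h2 h3]].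
apply: nreg; split=> // x y rxy iox; apply: contrapT => ioy.
by apply: h3; exists (x, y).
Qed.

End chain.

(** * Walks, and the BSCC in which a regular path ends *)

Lemma walk_refl (Y : Type) (e : Y -> Y -> Prop) x : walk e x x.
Proof. by exists [::]. Qed.

Lemma walk_trans (Y : Type) (e : Y -> Y -> Prop) x y z :
  walk e x y -> walk e y z -> walk e x z.
Proof.
move=> [p [xp lp]] [q [yq lq]]; exists (p ++ q).
by rewrite cat_path xp last_cat lp.
Qed.

Lemma walk1 (Y : Type) (e : Y -> Y -> Prop) x y : e x y -> walk e x y.
Proof. by move=> exy; exists [:: y] => /=; rewrite andbT; split=> //; apply/asboolP. Qed.

Lemma walk_path (Y : Type) (e : Y -> Y -> Prop) (w : nat -> Y) :
  (forall i, e (w i) (w i.+1)) -> forall i j, (i <= j)%N -> walk e (w i) (w j).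
Proof.
move=> ew i j /subnKC <-; elim: (j - i)%N => [|k IHk].
  by rewrite addn0; exact: walk_refl.
by rewrite addnS; apply: walk_trans IHk (walk1 _).
Qed.

Section bottom.
Context (R : realType) (AP : finType) (X : lmc R AP) (B : set (state X)).

Definition reach_class (b : state X) : set (state X) := [set c | B c /\ reach X b c].

Lemma graph_walk_reach (x y : state X) : walk (graph_edge X B) x y -> reach X x y.
Proof.
move=> [p [+ <-]]; elim: p x => [|z p IHp] x /=; first by move=> _; exact: walk_refl.
by move=> /andP[/asboolP[_ _ xz] /IHp]; exact: walk_trans.
Qed.

(** Any two elements are joined through [b]. The class is closed by transitivity, and maximal
    because a strongly connected superset contains [b] and hence only states reachable from it. *)
Lemma bscc_reach_class (b : state X) : B b ->
  (forall c, reach_class b c -> reach X c b) ->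
  bscc B (graph_edge X B) (reach_class b).
Proof.
move=> Bb back; split; last first.
  by move=> x y [_ bx] [_ By xy]; split=> //; exact: walk_trans bx xy.
split.
- by exists b; split=> //; exact: walk_refl.
- by move=> c [].
- move=> x y [Bx bx] [By bY]; apply: walk1; split=> //.
  by apply: walk_trans bY; exact: back.
- move=> D bD DB Dsc; apply/seteqP; split=> // d Dd; split; first exact: DB.
  have Db : D b by apply: bD; split=> //; exact: walk_refl.
  exact: graph_walk_reach (Dsc _ _ Db Dd).
Qed.

Lemma bscc_eq_reach_class (C : set (state X)) (b : state X) :
  bscc B (graph_edge X B) C -> C b -> bscc B (graph_edge X B) (reach_class b) ->
  C = reach_class b.
Proof.
move=> [[_ CB Csc Cmax] Cbot] Cb [[_ _ sc _] _].
apply/esym; apply: Cmax => //; last by move=> c [].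
move=> c Cc; split; first exact: CB.
exact: graph_walk_reach (Csc _ _ Cb Cc).
Qed.

Lemma regular_bscc (w : paths (state X)) : finite_set B -> regular B w ->
  exists2 b, B b & [/\ bscc B (graph_edge X B) (reach_class b),
    visits (reach_class b) w,
    exists n, forall i, (n <= i)%N -> reach X b (w i),
    forall y, reach X b y -> infinitely_often [set y] w &
    forall C, bscc B (graph_edge X B) C -> visits C w -> C = reach_class b].
Proof.
move=> finB [wpos ioB rec].
have wreach i j : (i <= j)%N -> reach X (w i) (w j).
  exact: (@walk_path _ (fun x y => 0 < trans X x [set y]) w wpos).
have [b Bb iob] := infinitely_often_finite finB ioB.
have [n _ wn] := iob 0%N.
have nb i : (n <= i)%N -> reach X b (w i) by rewrite -wn; exact: wreach.
have bio y : reach X b y -> infinitely_often [set y] w by move=> /rec; exact.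
have Cb : bscc B (graph_edge X B) (reach_class b).
  (* A visit to [c] exists by recurrence, and [b] is visited again later: the path itself leads from
     [c] back to [b]. *)
  apply: bscc_reach_class => // c [_ /bio /(_ 0%N)[i _ <-]].
  by have [j ij <-] := iob i; exact: wreach.
exists b => //; split=> //.
- by exists n; rewrite wn; split=> //; exact: walk_refl.
- by exists n.
(* After its visit to [C] at time [i] the path meets [b] again, so there is an edge from [w i] to
   [b], and [C], being bottom, contains [b]. *)
- move=> C bC [i Ci]; apply: bscc_eq_reach_class => //.
  have [j ij wj] := iob i; apply: (bC.2 (w i)) => //.
  case: bC => -[_ CB _ _] _; split=> //; first exact: CB.
  by rewrite -wj; exact: wreach.
Qed.

End bottom.

(** * The Muller condition on regular paths *)

Section muller.
Context (R : realType) (AP : finType) (T : lmc R AP) (M : muller AP).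
Let X := prod_lmc T M.
Implicit Types (F : {set {set mstate M}}) (B C : set (state X)).

(** As the automaton is finite, the event is a finite union, over accepting sets, of finite
    intersections of recurrence events and their complements. *)
Lemma measurable_inf_in F :
  measurable (@inf_in R AP T M F : set (paths (state X))).
Proof.
rewrite (_ : inf_in F = \bigcup_(A in [set A | A \in F]) \bigcap_(q in setT)
    [set w | (q \in inf_states w) = (q \in A)]).
  apply: fin_bigcup_measurable => [|A _]; first exact: finite_finset.
  apply: fin_bigcap_measurable => [|q _]; first exact: finite_finset.
  have mq : measurable ([set w | q \in inf_states w] : set (paths (state X))).
    rewrite (_ : [set _ | _] = infinitely_often [set x : state X | x.2 = q]).
      exact: measurable_infinitely_often.
    by apply/seteqP; split=> w /=; rewrite inE => /asboolP.
  case: (q \in A); first exact: mq.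
  rewrite (_ : [set _ | _] = ~` [set w | q \in inf_states w]).
    exact: measurableC.
  by apply/seteqP; split=> w /=; [move=> ->|move=> /negP/negbTE].
apply/seteqP; split=> w /=; first by move=> wF; exists (inf_states w).
move=> [A AF h]; rewrite /inf_in/= (_ : inf_states w = A)//.
by apply/setP => q; exact: h.
Qed.

(** By the two path hypotheses, [inf_states w] consists of the automaton components of the states
    reachable from [b]. The states reachable from the class of [b] are the same, so the set
    witnessing goodness can only be [inf_states w]. *)
Lemma good_for_inf_in F B (b : state X) (w : paths (state X)) :
  B b -> (exists n, forall i, (n <= i)%N -> reach X b (w i)) ->
  (forall y, reach X b y -> infinitely_often [set y] w) ->
  good_for F (reach_class B b) <-> inf_in F w.
Proof.
move=> Bb [n nb] bio.
have Cb : reach_class B b b by split=> //; exact: walk_refl.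
have infP q : q \in inf_states w <-> exists s, reach X b (s, q).
  rewrite inE; split=> [/asboolP/(_ n)[i ni]|[s /bio ios]].
    case wi : (w i) => [s q'] /= e; exists s.
    by rewrite -e -wi; exact: nb.
  by apply/asboolP => m; have [i mi wi] := ios m; exists i => //; rewrite wi.
split=> [[A AF [Ain Aex]]|wF].
  rewrite /inf_in /= (_ : inf_states w = A)//; apply/setP => q; apply/idP/idP.
    by move=> /infP[s bs]; exact: (Ain b (s, q)).
  move=> /Aex[s [x [[_ bx] xs]]]; apply/infP; exists s.
  exact: walk_trans bx xs.
exists (inf_states w) => //; split=> [x [s q] [_ bx] xs|q /infP[s bs]].
  by apply/infP; exists s; exact: walk_trans bx xs.
by exists s, b.
Qed.

End muller.

Unset Implicit Arguments.

Theorem corollary54 (R : realType) (AP : finType) (T : lmc R AP)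
    (fin_attr : exists A : set (state T), finite_set A /\ attractor T A)
    (M : muller AP) (B : set (state (prod_lmc T M)))
    (finB : finite_set B) (attrB : attractor (prod_lmc T M) B)
    (mu : Dist R (state T)) :
  Prob (prod_lmc T M) (init M mu) (inf_in (macc M)) = 1 <->
  (forall C : set (state (prod_lmc T M)),
     bscc B (graph_edge (prod_lmc T M) B) C ->
     0 < Prob (prod_lmc T M) (init M mu) (visits C) ->
     good_for (macc M) C).
Proof.
set P := Prob _ _.
have minf := @measurable_inf_in R AP T M (macc M).
have nreg : P.-negligible (~` regular B) by exact: negligible_not_regular.
split=> [Pinf C bC PC|good].
  have Pninf : P.-negligible (~` inf_in (macc M)).
    apply/negligibleP; first exact: measurableC.
    by rewrite [LHS]probability_setC// Pinf subee.
  (* Otherwise two negligible sets would cover [visits C], which has positive probability. This one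
     path suffices to decide that [C] is good. *)
  have [w [Cw wreg winf]] : exists w, [/\ visits C w, regular B w & inf_in (macc M) w].
    apply: contrapT => nex; have : P (visits C) = 0.
      apply: measure_negligible; first exact: measurable_visits.
      apply: negligibleS (negligibleU nreg Pninf) => w Cw.
      apply: contrapT => /not_orP[/contrapT ? /contrapT ?].
      by apply: nex; exists w.
    by move=> PC0; move: PC; rewrite PC0 ltxx.
  have [b Bb [_ _ bn bio /(_ C bC Cw) ->]] := regular_bscc finB wreg.
  exact/(good_for_inf_in (macc M) Bb bn bio).
(* Goodness is assumed only for a BSCC visited with positive probability, so paths visiting a class
   of visiting probability 0 are discarded; there are countably many such classes. *)
pose N b := [set w | P (visits (reach_class B b)) = 0 /\ visits (reach_class B b) w].
have N0 : P.-negligible (\bigcup_b N b).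
  apply: negligible_bigcup_countable => [|b].
    exact: (state_countable (prod_lmc T M)).
  have [b0|bn0] := pselect (P (visits (reach_class B b)) = 0); last first.
    by apply: negligibleS (negligible_set0 P) => w [].
  have : P.-negligible (visits (reach_class B b)).
    by apply/negligibleP => //; exact: measurable_visits.
  by apply: negligibleS => w [].
suff Pninf : P (~` inf_in (macc M)) = 0.
  move: Pninf; rewrite probability_setC// => /eqP.
  by rewrite sube_eq// add0e eq_sym => /eqP.
apply: measure_negligible; first exact: measurableC.
apply: negligibleS (negligibleU nreg N0) => w winf.
apply: contrapT => /not_orP[/contrapT wreg wN].
have [b Bb [bb bw bn bio _]] := regular_bscc finB wreg.
apply: winf; apply/(good_for_inf_in (macc M) Bb bn bio).
apply: good => //; rewrite lt_neqAle measure_ge0 andbT eq_sym.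
by apply/eqP => b0; apply: wN; exists b.
Qed.
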